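(* Let $G=(V,b,m)$ be a model graph. Then $G$ is $L^1$-Liouville if and only if it is stochastically complete.
   Context: A graph is a triple $G=(V,b,m)$, where $V$ is the (countable) set of vertices, $b:V\times V\to[0,\infty)$ is symmetric and vanishes on the diagonal, and $m:V\to(0,\infty)$. Write $x\sim y$ if $b(x,y)\neq 0$. All graphs are assumed connected (any two vertices are joined by a finite path $x=x_0\sim x_1\sim\dots\sim x_n=y$) and locally finite ($\{y: b(x,y)\ne 0\}$ is finite for every $x$). $d(x,y)$ is the combinatorial distance (minimal number of edges in a path from $x$ to $y$). The Laplacian is $\Delta f(x)=\frac1{m(x)}\sum_{y\in V}b(x,y)(f(x)-f(y))$ for $f:V\to\mathbb R$ (positive sign convention). $L^1(V,m)$ is the set of functions $u$ on $V$ with $\sum_{x\in V}|u(x)|m(x)<\infty$. $G$ is $L^1$-Liouville if every non-negative $u\in L^1(V,m)$ with $\Delta u\ge 0$ on $V$ is constant. For a fixed vertex $x_0$ put $S_r(x_0)=\{y: d(x_0,y)=r\}$. For $x\in S_r(x_0)$ the outer and inner curvatures are $k_{\pm}(x)=\frac1{m(x)}\sum_{y\in S_{r\pm1}(x_0)}b(x,y)$. $G$ is a model graph (weakly spherically symmetric graph) with root $x_0$ if, for every $r\ge 0$, $k_+$ and $k_-$ are constant on $S_r(x_0)$. The heat kernel $p_t(x,y)$ of $G$ is the minimal positive solution of $(\partial_t+\Delta_y)p_t(x,y)=0$ for $t>0$, $p_0(x,y)=\delta_x(y)/m(x)$; one always has $\sum_{y}p_t(x,y)m(y)\le 1$. $G$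 is stochastically complete if $\sum_{y\in V}p_t(x,y)m(y)=1$ for every $x\in V$ and every $t>0$. *)

(* Defs.v *)
From HB Require Import structures.
From mathcomp Require Import all_boot all_order all_algebra.
From mathcomp Require Import all_classical all_reals all_analysis.
Set Implicit Arguments.
Unset Strict Implicit.
Unset Printing Implicit Defensive.
Import Order.TTheory GRing.Theory Num.Theory.
Import numFieldNormedType.Exports.
Local Open Scope classical_set_scope.
Local Open Scope ring_scope.

Record graph (R : realType) (V : countType) := Graph {
  weight : V -> V -> R;
  vmeas : V -> R;
  weight_ge0 : forall x y, 0 <= weight x y;
  weightC : forall x y, weight x y = weight y x;
  weightxx : forall x, weight x x = 0;
  vmeas_gt0 : forall x, 0 < vmeas x;
  graph_connected : forall x y, exists s : seq V,
    path (fun u v => weight u v != 0) x s /\ last x s = y;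
  graph_locally_finite : forall x, finite_set [set y | weight x y != 0] }.

Section GraphDefs.
Variables (R : realType) (V : countType) (G : graph R V).
Implicit Types (x y : V) (u f : V -> R) (t : R).

Definition adj : rel V := fun x y => weight G x y != 0.

Definition has_walk (n : nat) x y : Prop :=
  exists s : seq V, [/\ size s = n, path adj x s & last x s = y].

Lemma has_walk_ex x y : exists n, `[< has_walk n x y >].
Proof.
by have [s [ps ls]] := graph_connected G x y; exists (size s); apply/asboolP; exists s.
Qed.

Definition gdist x y : nat := ex_minn (has_walk_ex x y).

(* The finitely supported sum is the full sum over V by local finiteness. *)
Definition laplacian f x : R :=
  (vmeas G x)^-1 * \sum_(y \in [set: V]) (weight G x y * (f x - f y)).

Definition L1 u : Prop :=
  (\esum_(x in [set: V]) (`|u x| * vmeas G x)%:E < +oo)%E.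

Definition L1_Liouville : Prop :=
  forall u, (forall x, 0 <= u x) -> L1 u -> (forall x, 0 <= laplacian u x) ->
  exists c : R, forall x, u x = c.

Definition sphere x0 (r : nat) : set V := [set y | gdist x0 y = r].

Definition outer_curvature x0 x : R :=
  (vmeas G x)^-1 * \sum_(y \in sphere x0 (gdist x0 x).+1) weight G x y.

(* The index set is the sphere of radius r - 1 for r = d(x0, x), written
   without truncated subtraction, so that it is empty when r = 0. *)
Definition inner_curvature x0 x : R :=
  (vmeas G x)^-1 *
  \sum_(y \in [set y | (gdist x0 y).+1 = gdist x0 x]) weight G x y.

Definition model_graph x0 : Prop :=
  forall (r : nat) x y, sphere x0 r x -> sphere x0 r y ->
    outer_curvature x0 x = outer_curvature x0 y /\
    inner_curvature x0 x = inner_curvature x0 y.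

(* Non-negative solutions of the heat equation started at delta_x / m(x). The
   right-continuity at 0 is what ties the solution on t > 0 to its initial
   value. *)
Definition heat_solution x (q : R -> V -> R) : Prop :=
  [/\ forall t y, 0 <= t -> 0 <= q t y,
      forall y, q 0 y = (y == x)%:R / vmeas G x,
      forall y, q t y @[t --> 0^'+] --> q 0 y
    & forall t y, 0 < t ->
        derivable (fun s => q s y) t 1 /\
        (fun s => q s y)^`()%classic t + laplacian (q t) y = 0].

(* Minimality determines p t x y uniquely for t >= 0. *)
Definition heat_kernel (p : R -> V -> V -> R) : Prop :=
  forall x, heat_solution x (fun t => p t x) /\
    forall q, heat_solution x q -> forall t y, 0 <= t -> p t x y <= q t y.

Definition stochastically_complete : Prop :=
  exists p, heat_kernel p /\
    forall x t, 0 < t -> (\esum_(y in [set: V]) (p t x y * vmeas G y)%:E = 1)%E.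

End GraphDefs.

(* Main.v *)
(* For finite B let p^B be the heat kernel of the Laplacian with Dirichlet
   condition off B.  Pairing p^B(T - s) with a supersolution g(s) gives a
   quantity monotone in s, which is a maximum principle; along the exhaustion
   by balls the p^B increase to the minimal heat kernel.

   Stochastic completeness implies L^1-Liouville on every graph: if u >= 0 is
   superharmonic, in L^1, and Delta u (z0) > 0, comparing with
   u - e s 1_{z0} and using the symmetry of p^B shows that the sum of
   m u (1 - P^B 1) stays bounded below, while it tends to 0 by completeness.
   So u is harmonic; applied to min (u, u x), which is maximal at x, this makes
   u constant.

   Conversely let V_r be the measure of the ball of radius r and D_r the total
   weight across its boundary.  If sum V_r / D_r < oo, the Green function
   w(r) = sum_(k >= r) 1 / D_k is superharmonic, non-constant, with L^1 norm
   sum V_r / D_r, so G is not L^1-Liouville.  If the sum diverges, then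
   v(r) = sum_(k < r) V_k / D_k tends to infinity with Delta v = -1, and
   comparison with (v + s) / c - 1 (Khasminskii) gives completeness. *)
Require Import Defs.
From mathcomp Require Import all_boot all_order all_algebra.
From mathcomp Require Import all_classical all_reals all_analysis.
From mathcomp Require Import finmap ring lra.
Set Implicit Arguments.
Unset Strict Implicit.
Unset Printing Implicit Defensive.
Import Order.TTheory GRing.Theory Num.Theory.
Import numFieldNormedType.Exports.
Local Open Scope classical_set_scope.
Local Open Scope ring_scope.

(** * Finite sums over duplicate-free lists, with their derivatives and limits *)

Lemma le_sum_uniq (R : numDomainType) (T : eqType) (s s' : seq T) (F : T -> R) :
  uniq s -> uniq s' ->
  (forall y, y \in s -> y \notin s' -> F y <= 0) ->
  (forall y, y \in s' -> y \notin s -> 0 <= F y) ->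
  \sum_(y <- s) F y <= \sum_(y <- s') F y.
Proof.
move=> us us' Fs Fs'; pose S := undup (s ++ s').
have restrict r : uniq r -> {subset r <= S} ->
    \sum_(y <- r) F y = \sum_(y <- S) if y \in r then F y else 0.
  move=> ur rS; rewrite -big_mkcond -big_filter; apply: perm_big.
  apply: uniq_perm => // [|y]; first by rewrite filter_uniq ?undup_uniq.
  by rewrite mem_filter; case: (boolP (y \in r)) => //= /rS ->.
rewrite (restrict s) // ?(restrict s') //; first last.
- by move=> y ys; rewrite mem_undup mem_cat ys.
- by move=> y ys; rewrite mem_undup mem_cat ys orbT.
apply: ler_sum => y _.
have := Fs y; have := Fs' y.
by case: (y \in s); case: (y \in s') => //=; [move=> _; exact | move=> h _; exact: h].
Qed.

Lemma eq_sum_uniq (R : numDomainType) (T : eqType) (s s' : seq T) (F : T -> R) :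
  uniq s -> uniq s' ->
  (forall y, F y != 0 -> (y \in s) = (y \in s')) ->
  \sum_(y <- s) F y = \sum_(y <- s') F y.
Proof.
move=> us us' F0; apply/eqP; rewrite eq_le.
have F0l y : y \in s -> y \notin s' -> F y = 0.
  by move=> ys /negbTE ys'; apply/eqP/negPn/negP => /F0; rewrite ys ys'.
have F0r y : y \in s' -> y \notin s -> F y = 0.
  by move=> ys /negbTE ys'; apply/eqP/negPn/negP => /F0; rewrite ys ys'.
by apply/andP; split; apply: le_sum_uniq => // y y1 y2; rewrite ?(F0l _ y1 y2) ?(F0r _ y1 y2).
Qed.

Lemma is_derive1_sum (R : realType) (T : eqType) (s : seq T) (h : T -> R -> R)
    (dh : T -> R) (x : R) :
  (forall i, i \in s -> is_derive x 1 (h i) (dh i)) ->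
  is_derive x 1 (fun t => \sum_(i <- s) h i t) (\sum_(i <- s) dh i).
Proof.
elim: s => [_|a s IH H].
  rewrite big_nil (_ : (fun _ => _) = cst 0); first exact: is_derive_cst.
  by apply/funext => t; rewrite big_nil.
rewrite big_cons (_ : (fun _ => _) = h a + (fun t => \sum_(i <- s) h i t)); last first.
  by apply/funext => t; rewrite big_cons.
apply: is_deriveD; first by apply: H; rewrite mem_head.
by apply: IH => i si; apply: H; rewrite inE si orbT.
Qed.

Lemma is_derive1M (R : realType) (f g : R -> R) (df dg x : R) :
  is_derive x 1 f df -> is_derive x 1 g dg ->
  is_derive x 1 (fun t => f t * g t) (df * g x + f x * dg).
Proof.
move=> hf hg; apply: (is_derive_eq (is_deriveM hf hg)).
by rewrite /GRing.scale /=; ring.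
Qed.

Lemma is_derive1_flip (R : realType) (f : R -> R) (df T x : R) :
  is_derive (T - x) 1 f df -> is_derive x 1 (fun t => f (T - t)) (- df).
Proof.
move=> hf.
have h : is_derive x 1 (fun t : R => T - t) (-1).
  apply: (is_derive_eq (is_deriveB (is_derive_cst T x 1) (is_derive_id x (1 : R)))).
  by rewrite sub0r.
apply: (is_derive_eq (@is_derive1_comp _ f (fun t => T - t) x df (-1) hf h)).
by rewrite mulrN1.
Qed.

Lemma cvg_sum_seq (R : realType) (I : Type) (F : set_system I) (FF : Filter F)
    (T : eqType) (s : seq T) (f : T -> I -> R) (l : T -> R) :
  (forall i, i \in s -> f i n @[n --> F] --> l i) ->
  \sum_(i <- s) f i n @[n --> F] --> \sum_(i <- s) l i.
Proof.
elim: s => [_|a s IH H].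
  rewrite big_nil (_ : (fun _ => _) = cst 0); first exact: cvg_cst.
  by apply/funext => t; rewrite big_nil.
rewrite big_cons (_ : (fun _ => _) = f a \+ (fun t => \sum_(i <- s) f i t)); last first.
  by apply/funext => t; rewrite big_cons.
apply: cvgD; first by apply: H; rewrite mem_head.
by apply: IH => i si; apply: H; rewrite inE si orbT.
Qed.

(** * Dirichlet heat kernels on finite sets *)

Section Dirichlet.
Variables (R : realType) (V : countType) (G : graph R V).
Implicit Types (x y z : V) (B : seq V) (f : V -> R).
Local Notation b := (weight G).
Local Notation m := (vmeas G).

Definition nbr x : seq V := fset_set [set y | b x y != 0].

Lemma nbr_uniq x : uniq (nbr x). Proof. exact: fset_uniq. Qed.

Lemma mem_nbr x y : (y \in nbr x) = (b x y != 0).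
Proof.
rewrite in_fset_set; last exact: graph_locally_finite.
by apply/idP/idP => [/set_mem|h]; last exact/mem_set.
Qed.

Lemma vmeas_neq0 x : m x != 0. Proof. by rewrite gt_eqF ?vmeas_gt0. Qed.

Lemma vmeasV_ge0 x : 0 <= (m x)^-1.
Proof. by rewrite invr_ge0 ltW ?vmeas_gt0. Qed.

Definition deg x : R := (m x)^-1 * \sum_(y <- nbr x) b x y.

Lemma deg_ge0 x : 0 <= deg x.
Proof. by rewrite mulr_ge0 ?vmeasV_ge0 // sumr_ge0 // => y _; exact: weight_ge0. Qed.

Lemma laplacian_nbr f x :
  laplacian G f x = (m x)^-1 * \sum_(y <- nbr x) b x y * (f x - f y).
Proof.
rewrite /laplacian (fsbigE (nbr x)) ?nbr_uniq //.
- by congr (_ * _); apply: eq_bigl => y; rewrite in_setT.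
- by move=> y _; rewrite mem_nbr negbK => /eqP ->; rewrite mul0r.
Qed.

Lemma laplacianE f x :
  laplacian G f x = deg x * f x - (m x)^-1 * \sum_(y <- nbr x) b x y * f y.
Proof.
rewrite laplacian_nbr /deg -mulrA -mulrBr mulr_suml -sumrB.
by congr (_ * _); apply: eq_bigr => y _; rewrite mulrBr.
Qed.

(* The Laplacian of [f] restricted to [B] and extended by [0]. *)
Definition dlap B f x : R :=
  deg x * f x - (m x)^-1 * \sum_(y <- B) b x y * f y.

(** The weights enter [dlap] with a minus sign, so dropping points where [f <= 0] and adding points
    where [f >= 0] can only lower it. *)
Lemma le_dlap B B' f x : uniq B -> uniq B' ->
  (forall y, y \in B -> y \notin B' -> f y <= 0) ->
  (forall y, y \in B' -> y \notin B -> 0 <= f y) ->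
  dlap B' f x <= dlap B f x.
Proof.
move=> uB uB' h h'; rewrite lerD2l lerN2 ler_wpM2l ?vmeasV_ge0 //.
apply: le_sum_uniq => // y y1 y2.
  by rewrite mulr_ge0_le0 ?weight_ge0 ?h.
by rewrite mulr_ge0 ?weight_ge0 ?h'.
Qed.

Lemma laplacian_dlap B f x : uniq B -> (forall y, b x y != 0 -> y \in B) ->
  laplacian G f x = dlap B f x.
Proof.
move=> uB hB; rewrite laplacianE /dlap; congr (_ - _ * _).
apply: eq_sum_uniq => // [|y]; first exact: nbr_uniq.
rewrite mulf_eq0 negb_or => /andP[bxy _].
by rewrite mem_nbr bxy hB.
Qed.

(** Adjoining the neighbours of [x] to [B] turns [dlap] into the full Laplacian, and the new points
    have [f >= 0]. This makes supersolutions of the full equation supersolutions of the Dirichlet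
    one. *)
Lemma laplacian_le_dlap B f x : uniq B -> (forall y, y \notin B -> 0 <= f y) ->
  laplacian G f x <= dlap B f x.
Proof.
move=> uB f0; pose S := undup (B ++ nbr x).
rewrite (@laplacian_dlap S) ?undup_uniq //; last first.
  by move=> y; rewrite -mem_nbr mem_undup mem_cat => ->; rewrite orbT.
apply: le_dlap; rewrite ?undup_uniq // => y; last by move=> _; exact: f0.
by move=> yB; rewrite mem_undup mem_cat yB.
Qed.

(** A rate dominating every degree on [B], so that the diagonal coefficient of [step] is
    non-negative. *)
Definition unif B : R := 1 + \sum_(y <- B) deg y.

Lemma sum_deg_ge0 B : 0 <= \sum_(y <- B) deg y.
Proof. by rewrite sumr_ge0 // => y _; exact: deg_ge0. Qed.

Lemma deg_le_unif B y : y \in B -> deg y <= unif B.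
Proof.
move=> yB; rewrite (@le_trans _ _ (\sum_(y <- B) deg y)) ?lerDr //.
by rewrite (big_rem y) //= lerDl sum_deg_ge0.
Qed.

Definition step B f y : R :=
  if y \in B then (unif B - deg y) * f y + (m y)^-1 * \sum_(z <- B) b y z * f z
  else 0.

Lemma step_ge0 B f : (forall y, 0 <= f y) -> forall y, 0 <= step B f y.
Proof.
move=> f0 y; rewrite /step; case: ifP => // yB.
rewrite addr_ge0 ?mulr_ge0 ?subr_ge0 ?deg_le_unif ?vmeasV_ge0 //.
by rewrite sumr_ge0 // => z _; rewrite mulr_ge0 ?weight_ge0.
Qed.

(** Powers of [step B] applied to the point mass at [x]: the Taylor coefficients of [exp (t step B)]
    before division by [k!]. *)
Definition coef B x (k : nat) : V -> R :=
  iter k (step B) (fun y => if (y == x) && (y \in B) then (m x)^-1 else 0).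

Lemma coef_ge0 B x k y : 0 <= coef B x k y.
Proof.
elim: k y => [y|k IH] /=; first by case: ifP => // _; exact: vmeasV_ge0.
exact: step_ge0.
Qed.

(** A crude bound for the sup norm of [step B], giving geometric growth of [coef]. *)
Definition unif_bound B : R :=
  unif B + \sum_(y <- B) (m y)^-1 * \sum_(z <- B) b y z.

Lemma unif_bound_ge0 B : 0 <= unif_bound B.
Proof.
rewrite !addr_ge0 ?sum_deg_ge0 // sumr_ge0 // => y _.
by rewrite mulr_ge0 ?vmeasV_ge0 // sumr_ge0 // => z _; exact: weight_ge0.
Qed.

Lemma coef_bound B x k y : coef B x k y <= (m x)^-1 * unif_bound B ^+ k.
Proof.
elim: k y => [y|k IH y] /=.
  by rewrite expr0 mulr1; case: ifP => // _; exact: vmeasV_ge0.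
rewrite /step; case: ifP => [yB|_]; last first.
  by rewrite mulr_ge0 ?vmeasV_ge0 ?exprn_ge0 ?unif_bound_ge0.
set M := (m x)^-1 * unif_bound B ^+ k in IH *.
have M0 : 0 <= M by exact: le_trans (coef_ge0 B x k y) (IH y).
rewrite exprS mulrCA -/M [X in _ <= X * M]/unif_bound [leRHS]mulrDl lerD //.
  apply: ler_pM; rewrite ?subr_ge0 ?deg_le_unif ?coef_ge0 ?IH //.
  by rewrite gerBl deg_ge0.
rewrite (@le_trans _ _ ((m y)^-1 * (\sum_(z <- B) b y z) * M)) //.
  rewrite -mulrA ler_wpM2l ?vmeasV_ge0 // mulr_suml.
  by apply: ler_sum => z _; rewrite ler_wpM2l ?weight_ge0.
rewrite ler_wpM2r // [leRHS](big_rem y) //= lerDl sumr_ge0 // => z _.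
by rewrite mulr_ge0 ?vmeasV_ge0 // sumr_ge0 // => w _; exact: weight_ge0.
Qed.

Definition kser B x y (k : nat) : R := coef B x k y / k`!%:R.

(** Domination by the series of [M exp (K |t|)]. *)
Lemma is_cvg_pseries_bounded (c : R^nat) (M K : R) (t : R) :
  0 <= M -> 0 <= K ->
  (forall k, 0 <= c k <= M * (K ^+ k / k`!%:R)) -> cvgn (pseries c t).
Proof.
move=> M0 K0 hc; apply: normed_cvg.
apply: (@series_le_cvg _ _ (fun k => M * exp_coeff (K * `|t|) k)).
- by move=> k /=.
- by move=> k; rewrite mulr_ge0 ?exp_coeff_ge0 ?mulr_ge0.
- move=> k /=; rewrite normrM normrX; have /andP[c0 ck] := hc k.
  rewrite (ger0_norm c0) /exp_coeff /= exprMn.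
  rewrite (@le_trans _ _ (M * (K ^+ k / k`!%:R) * `|t| ^+ k)) //.
    by rewrite ler_wpM2r ?exprn_ge0.
  by rewrite le_eqVlt; apply/orP; left; apply/eqP; ring.
- have := @is_cvg_seriesZ _ _ M (is_cvg_series_exp_coeff (K * `|t|)).
  by [].
Qed.

Lemma pseries_diffs_kser B x y :
  pseries_diffs (kser B x y) = (fun k => coef B x k.+1 y / k`!%:R).
Proof.
apply/funext => k; rewrite /pseries_diffs /kser factS natrM invfM.
by rewrite mulrCA; congr (_ * _); rewrite mulrA divff ?mul1r // pnatr_eq0.
Qed.

Lemma pseries_diffs2_kser B x y :
  pseries_diffs (pseries_diffs (kser B x y)) =
  (fun k => coef B x k.+2 y / k`!%:R).
Proof.
apply/funext => k; rewrite pseries_diffs_kser /pseries_diffs factS natrM invfM.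
by rewrite mulrCA; congr (_ * _); rewrite mulrA divff ?mul1r // pnatr_eq0.
Qed.

(** The shift [j] covers the kernel series ([j = 0]) and its first two derived series ([j = 1, 2]),
    whose convergence termwise differentiation requires. *)
Lemma is_cvg_coef B x y j t :
  cvgn (pseries (fun k => coef B x (j + k) y / k`!%:R) t).
Proof.
apply: (@is_cvg_pseries_bounded _ ((m x)^-1 * unif_bound B ^+ j) (unif_bound B)).
- by rewrite mulr_ge0 ?vmeasV_ge0 ?exprn_ge0 ?unif_bound_ge0.
- exact: unif_bound_ge0.
- move=> k; rewrite divr_ge0 ?coef_ge0 //= mulrA ler_wpM2r ?invr_ge0 //.
  by rewrite -mulrA -exprD coef_bound.
Qed.

Definition uker B x (t : R) y : R := limn (pseries (kser B x y) t).

Lemma is_derive_uker B x (t : R) y :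
  is_derive t 1 (fun s => uker B x s y) (step B (uker B x t) y).
Proof.
have c0 z s : cvgn (pseries (kser B x z) s).
  exact: (@is_cvg_coef B x z 0 s).
have c1 s : cvgn (pseries (pseries_diffs (kser B x y)) s).
  rewrite pseries_diffs_kser; exact: (@is_cvg_coef B x y 1 s).
have c2 s : cvgn (pseries (pseries_diffs (pseries_diffs (kser B x y))) s).
  rewrite pseries_diffs2_kser; exact: (@is_cvg_coef B x y 2 s).
have := @pseries_snd_diffs _ (kser B x y) (`|t| + 1) t (c0 y _) (c1 _) (c2 _).
have tt : `|t| < `| `|t| + 1| by rewrite [ltRHS]ger0_norm ?addr_ge0 // ltrDl.
move=> /(_ tt) /is_derive_eq; apply.
apply/cvg_lim => //.
(* Since [step B] is a finite linear combination, it commutes with partial sums and then with their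
   limit. *)
have -> : pseries (pseries_diffs (kser B x y)) t =
    (fun n => step B (fun z => pseries (kser B x z) t n) y).
  apply/funext => n; rewrite pseries_diffs_kser /pseries /series /step /=.
  rewrite /step; case: ifP => yB; last first.
    by apply: big1 => i _; rewrite !mul0r.
  under eq_bigr => i _ do rewrite mulrDl mulrDl.
  rewrite big_split /=; congr (_ + _).
    by rewrite mulr_sumr; apply: eq_bigr => i _; rewrite /kser -!mulrA.
  under [in RHS]eq_bigr => z _ do rewrite mulr_sumr.
  rewrite exchange_big /= mulr_sumr; apply: eq_bigr => i _.
  rewrite -!mulrA; congr (_ * _); rewrite mulr_suml.
  by apply: eq_bigr => z _; rewrite /kser -!mulrA.
rewrite /step; case: ifP => yB; last exact: cvg_cst.
apply: cvgD; first by apply: cvgMr; exact: c0.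
apply: cvgMr; apply: cvg_sum_seq => z _.
by apply: cvgMr; exact: c0.
Qed.

(* Uniformization: since [step B] is [unif B - dlap B], this is the kernel of
   [exp (- t dlap B)] with respect to [m], manifestly non-negative. *)
Definition kern B x (t : R) y : R := expR (- (unif B * t)) * uker B x t y.

Lemma kern_ge0 B x t y : 0 <= t -> 0 <= kern B x t y.
Proof.
move=> t0; rewrite mulr_ge0 ?expR_ge0 //.
apply: limr_ge; first exact: (@is_cvg_coef B x y 0 t).
near=> n; rewrite /pseries /series /=; apply: sumr_ge0 => i _.
by rewrite mulr_ge0 ?exprn_ge0 // divr_ge0 ?coef_ge0.
Unshelve. all: by end_near. Qed.

Lemma uker_out B x t y : y \notin B -> uker B x t y = 0.
Proof.
move=> /negbTE yB; rewrite /uker (_ : pseries _ _ = cst 0) ?lim_cst //.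
apply/funext => n; rewrite /pseries /series /=; apply: big1 => i _.
by rewrite /kser; case: i => [|i] /=; rewrite /step yB ?andbF /= !mul0r.
Qed.

Lemma kern_out B x t y : y \notin B -> kern B x t y = 0.
Proof. by move=> yB; rewrite /kern uker_out ?mulr0. Qed.

Lemma kern0 B x y :
  kern B x 0 y = if (y == x) && (y \in B) then (m x)^-1 else 0.
Proof.
rewrite /kern mulr0 oppr0 expR0 mul1r; apply/cvg_lim => //.
(* At [t = 0] only the term [k = 0] survives; the shift skips the empty partial sum. *)
rewrite -(cvg_shiftn 1) /= (_ : (fun n => _) = cst (coef B x 0 y)).
  exact: cvg_cst.
apply/funext => n; rewrite /pseries /series /= addn1 big_nat_recl //=.
rewrite big1 ?addr0 => [|i _]; last by rewrite expr0n /= mulr0.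
by rewrite /kser /= fact0 divr1 expr0 mulr1.
Qed.

Lemma is_derive_kern B x (t : R) y : y \in B ->
  is_derive t 1 (fun s => kern B x s y) (- dlap B (kern B x t) y).
Proof.
move=> yB; rewrite /kern.
have he : is_derive t 1 (fun s => expR (- (unif B * s)))
    (- unif B * expR (- (unif B * t))).
  have hl : is_derive t 1 (fun s : R => - (unif B * s)) (- unif B).
    apply: (is_derive_eq (is_deriveN (is_deriveZ (unif B) (is_derive_id t (1 : R))))).
    by rewrite /GRing.scale /= mulr1.
  apply: (is_derive_eq (@is_derive1_comp _ expR (fun s => - (unif B * s)) t _ _ (is_derive_expR _) hl)).
  by rewrite mulrC.
apply: (is_derive_eq (is_derive1M he (is_derive_uker B x t y))).
rewrite /step yB /dlap.
under [in RHS]eq_bigr => z _ do rewrite mulrCA.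
by rewrite -mulr_sumr; ring.
Qed.

End Dirichlet.

Lemma is_derive1_continuous (R : realType) (f : R -> R) (df x : R) :
  is_derive x 1 f df -> {for x, continuous f}.
Proof.
move=> hf; apply: differentiable_continuous; apply/derivable1_diffP.
exact: (@ex_derive _ _ _ _ _ _ _ hf).
Qed.

Lemma is_derive1_affine (R : realType) (a c x : R) :
  is_derive x 1 (fun s : R => a * s + c) a.
Proof.
apply: (is_derive_eq (is_deriveD (is_deriveZ a (is_derive_id x (1 : R)))
  (is_derive_cst c x 1))).
by rewrite /GRing.scale /= mulr1 addr0.
Qed.

(** * Comparison principle *)

Section Comparison.
Variables (R : realType) (V : countType) (G : graph R V).
Implicit Types (x y z : V) (B : seq V) (f u v : V -> R).
Local Notation b := (weight G).
Local Notation m := (vmeas G).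

(** The factor [m y] cancels the one in [dlap], leaving the symmetric matrix [b] on [B]. *)
Lemma dlap_sym B f g :
  \sum_(y <- B) m y * (g y * dlap G B f y) = \sum_(y <- B) m y * (f y * dlap G B g y).
Proof.
have expand h k : \sum_(y <- B) m y * (h y * dlap G B k y) =
    \sum_(y <- B) m y * deg G y * h y * k y
    - \sum_(y <- B) \sum_(z <- B) b y z * h y * k z.
  rewrite -sumrB; apply: eq_bigr => y _; rewrite /dlap !mulrBr.
  congr (_ - _); first by ring.
  rewrite (_ : m y * _ = m y * (m y)^-1 * (h y * \sum_(z <- B) b y z * k z)); last by ring.
  rewrite divff ?vmeas_neq0 // mul1r mulr_sumr.
  by apply: eq_bigr => z _; ring.
rewrite !expand exchange_big /=; congr (_ - _); first by apply: eq_bigr => y _; ring.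
by apply: eq_bigr => y _; apply: eq_bigr => z _; rewrite weightC; ring.
Qed.

(* Duality: [s |-> \sum_y g s y * m y * kern (T - s) y] is nondecreasing, with
   value [g T z] at [s = T]. *)
Lemma comparison B z (T : R) (g g' : R -> V -> R) :
  uniq B -> z \in B -> 0 < T ->
  (forall y, y \in B -> g t y @[t --> 0^'+] --> g 0 y) ->
  (forall t y, 0 < t -> t <= T -> y \in B -> is_derive t 1 (g^~ y) (g' t y)) ->
  (forall t y, 0 < t -> t <= T -> y \in B -> 0 <= g' t y + dlap G B (g t) y) ->
  \sum_(y <- B) kern G B z T y * m y * g 0 y <= g T z.
Proof.
move=> uB zB T0 g0 dg sup.
pose F s := \sum_(y <- B) (m y * g s y) * kern G B z (T - s) y.
have dF s : 0 < s -> s <= T -> is_derive s 1 F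
    (\sum_(y <- B) m y * (kern G B z (T - s) y * (g' s y + dlap G B (g s) y))).
  move=> s0 sT; have : is_derive s 1 F (\sum_(y <- B)
      (m y * g' s y * kern G B z (T - s) y + m y * g s y * dlap G B (kern G B z (T - s)) y)).
    apply: is_derive1_sum => y yB; apply: is_derive1M.
      apply: (is_derive_eq (is_deriveZ (m y) (dg s y s0 sT yB))).
      by [].
    rewrite -[X in is_derive _ _ _ X]opprK.
    exact: (@is_derive1_flip _ (fun t => kern G B z t y) _ T s (is_derive_kern _ z (T - s) yB)).
  move=> /is_derive_eq; apply.
  rewrite big_split /=.
  under [X in _ + X]eq_bigr do rewrite -mulrA.
  (* Symmetry moves [dlap] from the kernel onto [g s], where it joins the time derivative. *)
  rewrite dlap_sym -big_split /=; apply: eq_bigr => y _; ring.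
(* At [0] only right-continuity of [g] is assumed, so the endpoints are treated by one-sided
   limits. *)
have cF : {within `[0, T], continuous F}.
  apply/continuous_within_itvP => //; split.
  - move=> s; rewrite in_itv /= => /andP[s0 sT].
    exact: (is_derive1_continuous (dF s s0 (ltW sT))).
  - apply: cvg_sum_seq => y yB; apply: cvgM.
      by apply: cvgMr; exact: g0.
    apply: cvg_at_right_filter.
    have := @is_derive1_flip _ (fun t => kern G B z t y) _ T 0 (is_derive_kern _ z (T - 0) yB).
    by move=> /is_derive1_continuous.
  - apply: cvg_at_left_filter.
    exact: (is_derive1_continuous (dF T T0 (lexx _))).
have F0T : F 0 <= F T.
  apply: (@ger0_derive1_ndecr _ F 0 T) => //; rewrite ?lexx ?ltW //.
    move=> s; rewrite in_itv /= => /andP[s0 sT].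
    exact: (@ex_derive _ _ _ _ _ _ _ (dF s s0 (ltW sT))).
  move=> s; rewrite in_itv /= => /andP[s0 sT].
  rewrite derive1E (@derive_val _ _ _ _ _ _ _ (dF s s0 (ltW sT))).
  rewrite big_seq sumr_ge0 // => y yB.
  rewrite mulr_ge0 ?(ltW (vmeas_gt0 _ _)) // mulr_ge0 //.
    by rewrite kern_ge0 // subr_ge0 ltW.
  by apply: sup => //; exact: ltW.
have -> : \sum_(y <- B) kern G B z T y * m y * g 0 y = F 0.
  by apply: eq_bigr => y _; rewrite subr0; ring.
suff -> : g T z = F T by [].
(* At [s = T] the kernel is the point mass at [z], and the sum collapses. *)
rewrite /F subrr (bigD1_seq z) //= kern0 eqxx zB /=.
rewrite big1 => [|y /negbTE yz]; last by rewrite kern0 yz mulr0.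
by rewrite addr0 mulrAC divff ?vmeas_neq0 // mul1r.
Qed.

Lemma kern_at0 B x y : y \in B -> kern G B x 0 y = (y == x)%:R / m x.
Proof. by move=> yB; rewrite kern0 yB andbT; case: eqP; rewrite ?mul1r ?mul0r. Qed.

Lemma sum_delta B x f : uniq B -> x \in B ->
  \sum_(y <- B) f y * m y * ((y == x)%:R / m x) = f x.
Proof.
move=> uB xB; rewrite (bigD1_seq x) //= eqxx big1 => [|y /negbTE ->]; last by rewrite mul0r mulr0.
by rewrite addr0 mul1r -mulrA divff ?mulr1 ?vmeas_neq0.
Qed.

Lemma kern_out_source B x t y : x \notin B -> kern G B x t y = 0.
Proof.
move=> xB; have c0 k z : coef G B x k z = 0.
  elim: k z => [z|k IH z] /=.
    by case: eqP => [->|//]; rewrite (negbTE xB).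
  rewrite /step IH big1 ?mulr0 ?addr0 ?if_same // => w _; by rewrite IH mulr0.
rewrite /kern /uker (_ : pseries _ _ = cst 0) ?lim_cst ?mulr0 //.
by apply/funext => n; rewrite /pseries /series /=; apply: big1 => i _; rewrite /kser c0 !mul0r.
Qed.

Lemma kern_right_cont B x y : y \in B -> kern G B x t y @[t --> 0^'+] --> kern G B x 0 y.
Proof.
move=> yB; apply: cvg_at_right_filter.
exact: (is_derive1_continuous (is_derive_kern G x 0 yB)).
Qed.

(** Taking one kernel as [g] in the comparison gives an inequality between the two values;
    exchanging the roles gives the other. *)
Lemma kernC B x y (t : R) : uniq B -> 0 <= t -> kern G B x t y = kern G B y t x.
Proof.
move=> uB; rewrite le_eqVlt => /predU1P[<-|t0].
  rewrite !kern0 [x == y]eq_sym; case: eqP => [->|//] /=.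
  by [].
have [xB|xB] := boolP (x \in B); last by rewrite kern_out_source // kern_out.
have [yB|yB] := boolP (y \in B); last by rewrite kern_out // kern_out_source.
have half (u v : V) : u \in B -> v \in B -> kern G B v t u <= kern G B u t v.
  move=> uB' vB; have := @comparison B v t (fun s => kern G B u s)
    (fun s w => - dlap G B (kern G B u s) w) uB vB t0.
  rewrite (eq_big_seq (fun w => kern G B v t w * m w * ((w == u)%:R / m u))); last first.
    by move=> w wB; rewrite kern_at0.
  rewrite sum_delta //; apply.
  - by move=> w wB; exact: kern_right_cont.
  - by move=> s w _ _ wB; exact: is_derive_kern.
  - by move=> s w _ _ _; rewrite addNr.
by apply/eqP; rewrite eq_le !half.
Qed.

(** For a point mass as initial value, the sum in [comparison] reduces to [kern G B z T x], and
    symmetry exchanges source and target. *)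
Lemma kern_le_supersolution B x z (T : R) (g g' : R -> V -> R) :
  uniq B -> 0 < T -> 0 <= g T z ->
  (forall y, y \in B -> g t y @[t --> 0^'+] --> g 0 y) ->
  (forall y, y \in B -> g 0 y = (y == x)%:R / m x) ->
  (forall t y, 0 < t -> t <= T -> y \in B -> is_derive t 1 (g^~ y) (g' t y)) ->
  (forall t y, 0 < t -> t <= T -> y \in B -> 0 <= g' t y + dlap G B (g t) y) ->
  kern G B x T z <= g T z.
Proof.
move=> uB T0 gTz cg g0 dg sup.
have [zB|zB] := boolP (z \in B); last by rewrite kern_out.
have [xB|xB] := boolP (x \in B); last by rewrite kern_out_source.
rewrite kernC ?(ltW T0) //.
have := comparison uB zB T0 cg dg sup.
rewrite (eq_big_seq (fun w => kern G B z T w * m w * ((w == x)%:R / m x))); last first.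
  by move=> w wB; rewrite g0.
by rewrite sum_delta.
Qed.

(** The kernel of the larger set is non-negative off [B], hence a supersolution for [B]. *)
Lemma le_kern B B' x (t : R) z : uniq B -> uniq B' -> {subset B <= B'} -> 0 <= t ->
  kern G B x t z <= kern G B' x t z.
Proof.
move=> uB uB' BB'; rewrite le_eqVlt => /predU1P[<-|t0].
  rewrite !kern0; case: (z == x) => //=; case: (boolP (z \in B)) => [/BB' -> //|_].
  by case: ifP => // _; exact: vmeasV_ge0.
apply: (@kern_le_supersolution B x z t (fun s => kern G B' x s)
    (fun s w => - dlap G B' (kern G B' x s) w)) => //.
- by rewrite kern_ge0 //; exact: ltW.
- by move=> y /BB' yB; exact: kern_right_cont.
- by move=> y /BB' yB; exact: kern_at0.
- by move=> s y _ _ /BB' yB; exact: is_derive_kern.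
- move=> s y s0 _ _; rewrite addrC subr_ge0; apply: le_dlap => //.
    by move=> w /BB' ->.
  by move=> w _ _; rewrite kern_ge0 //; exact: ltW.
Qed.

Lemma kern_le_heat_solution B x (t : R) z q : uniq B -> 0 <= t ->
  heat_solution G x q -> kern G B x t z <= q t z.
Proof.
move=> uB t0 [q0 qi qc qd]; move: t0; rewrite le_eqVlt => /predU1P[<-|t0].
  rewrite qi kern0; case: (z == x) => /=; last by rewrite mul0r.
  by rewrite mul1r; case: ifP => // _; exact: vmeasV_ge0.
apply: (@kern_le_supersolution B x z t q (fun s w => - laplacian G (q s) w)) => //.
- by rewrite q0 //; exact: ltW.
- move=> s y s0 _ _; have [qd1 /eqP] := qd s y s0.
  rewrite addr_eq0 => /eqP <-; rewrite derive1E; exact: derivableP.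
- move=> s y s0 _ _; rewrite addrC subr_ge0.
  by apply: laplacian_le_dlap => // w _; rewrite q0 //; exact: ltW.
Qed.

Lemma laplacian_affine (a c : R) f x :
  laplacian G (fun y => a * f y + c) x = a * laplacian G f x.
Proof.
rewrite !laplacian_nbr mulrCA; congr (_ * _); rewrite mulr_sumr.
by apply: eq_bigr => y _; ring.
Qed.

(** The probability that the walk from [z], killed on leaving [B], survives to time [t]. *)
Definition mass B z (t : R) := \sum_(y <- B) kern G B z t y * m y.

(** Comparison with the constant [1]: its full Laplacian vanishes and is at most its [dlap]. *)
Lemma mass_le1 B z (t : R) : uniq B -> 0 <= t -> mass B z t <= 1.
Proof.
move=> uB t0; have [zB|zB] := boolP (z \in B); last first.
  by rewrite /mass big1 // => y _; rewrite kern_out_source // mul0r.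
move: t0; rewrite le_eqVlt => /predU1P[<-|t0].
  rewrite /mass (eq_big_seq (fun y => 1 * m y * ((y == z)%:R / m z))) ?sum_delta //.
  by move=> y yB; rewrite kern_at0 // mul1r mulrC.
have := @comparison B z t (fun _ _ => 1) (fun _ _ => 0) uB zB t0.
rewrite (eq_bigr (fun y => kern G B z t y * m y)); last by move=> y _; rewrite mulr1.
apply.
- by move=> y _; exact: cvg_cst.
- move=> s y _ _ _; rewrite add0r.
  have := @laplacian_le_dlap _ _ G B (fun=> 1) y uB (fun _ _ => ler01).
  apply: le_trans; rewrite -[X in laplacian _ X](_ : (fun _ => 0 * 1 + 1) = _).
    by rewrite (laplacian_affine 0 1 (fun=> 1)) mul0r.
  by apply/funext => w; rewrite mul0r add0r.
Qed.

(* Comparison with the supersolution [(v + s) / c - 1], [s] being the time. *)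
Lemma mass_ge B z (t : R) v (c : R) : uniq B -> z \in B -> 0 < t -> 0 < c ->
  (forall y, 0 <= v y) -> (forall y, y \notin B -> c <= v y) ->
  (forall y, y \in B -> -1 <= laplacian G v y) ->
  1 - (v z + t) / c <= mass B z t.
Proof.
move=> uB zB t0 c0 v0 vc lv.
have := @comparison B z t (fun s y => c^-1 * s + (c^-1 * v y - 1)) (fun _ _ => c^-1) uB zB t0.
have gE (s : R) : (fun y => c^-1 * s + (c^-1 * v y - 1)) =
    (fun y => c^-1 * v y + (c^-1 * s - 1)) by apply/funext => y; ring.
set P := (X in X -> _) => comp.
have {}comp : \sum_(y <- B) kern G B z t y * m y * (c^-1 * 0 + (c^-1 * v y - 1))
    <= c^-1 * t + (c^-1 * v z - 1).
  apply: comp.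
  - move=> y _; apply: cvg_at_right_filter.
    exact: (is_derive1_continuous (is_derive1_affine c^-1 (c^-1 * v y - 1) 0)).
  - by move=> s y _ _ _; exact: is_derive1_affine.
  - move=> s y s0 _ yB; rewrite gE.
    have := @laplacian_le_dlap _ _ G B (fun y => c^-1 * v y + (c^-1 * s - 1)) y uB.
    rewrite laplacian_affine => H.
    apply: (@le_trans _ _ (c^-1 + c^-1 * laplacian G v y)).
      rewrite -[X in X + _]mulr1 -mulrDr mulr_ge0 ?invr_ge0 ?(ltW c0) //.
      by have := lv y yB; lra.
    (* Outside [B], [c <= v] makes the supersolution non-negative, as the passage from [laplacian]
       to [dlap] demands. *)
    rewrite lerD2l; apply: H => w wB.
    have h1 : 1 <= c^-1 * v w by rewrite mulrC ler_pdivlMr // mul1r vc.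
    have h2 : 0 <= c^-1 * s by rewrite mulr_ge0 ?invr_ge0 ?(ltW c0) ?(ltW s0).
    lra.
(* The initial value [v / c - 1] is at least [-1]. *)
have : - mass B z t <= \sum_(y <- B) kern G B z t y * m y * (c^-1 * 0 + (c^-1 * v y - 1)).
  rewrite /mass -sumrN; apply: ler_sum => y _.
  rewrite mulr0 add0r -[leLHS]mulrN1 ler_wpM2l //.
    by rewrite mulr_ge0 ?kern_ge0 ?(ltW t0) ?(ltW (vmeas_gt0 _ _)).
  by rewrite lerBrDl subrr mulr_ge0 ?invr_ge0 ?(ltW c0).
have -> : (v z + t) / c = c^-1 * t + c^-1 * v z by ring.
by move: comp; lra.
Qed.

Lemma dlap_linear B (a c : R) f g y :
  dlap G B (fun w => a * f w + c * g w) y = a * dlap G B f y + c * dlap G B g y.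
Proof.
rewrite /dlap (_ : \sum_(z <- B) _ = a * \sum_(z <- B) b y z * f z
  + c * \sum_(z <- B) b y z * g z); first by ring.
by rewrite !mulr_sumr -big_split /=; apply: eq_bigr => z _; ring.
Qed.

(* Comparison with the supersolution [u - e s 1_{z0}], [s] being the time. *)
Lemma kern_superharmonic B z z0 (t : R) u (e : R) : uniq B -> z \in B -> 0 < t ->
  (forall y, 0 <= u y) -> (forall y, 0 <= laplacian G u y) ->
  0 <= e -> e * (1 + t * deg G z0) <= laplacian G u z0 ->
  \sum_(y <- B) kern G B z t y * m y * u y <= u z - e * t * (z == z0)%:R.
Proof.
move=> uB zB t0 u0 lu e0 he.
pose d y : R := (y == z0)%:R.
have := @comparison B z t (fun s y => (- e * d y) * s + u y) (fun _ y => - e * d y) uB zB t0.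
rewrite (eq_bigr (fun y => kern G B z t y * m y * u y)); last first.
  by move=> y _; rewrite mulr0 add0r.
rewrite (_ : - e * d z * t + u z = u z - e * t * (z == z0)%:R); last by rewrite /d; ring.
apply.
- move=> y _; apply: cvg_at_right_filter.
  exact: (is_derive1_continuous (is_derive1_affine (- e * d y) (u y) 0)).
- by move=> s y _ _ _; exact: is_derive1_affine.
- move=> s y s0 st yB.
  rewrite (_ : (fun y => _) = (fun w => 1 * u w + (- e * s) * d w)); last first.
    by apply/funext => w; ring.
  rewrite dlap_linear mul1r.
  have lud := @laplacian_le_dlap _ _ G B u y uB (fun w _ => u0 w).
  have sumd : 0 <= (m y)^-1 * \sum_(w <- B) b y w * d w.
    rewrite mulr_ge0 ?vmeasV_ge0 // sumr_ge0 // => w _.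
    by rewrite mulr_ge0 ?weight_ge0 // /d ler0n.
  have dd : dlap G B d y <= deg G y * d y by rewrite /dlap lerBlDr lerDl.
  have es : 0 <= e * s by rewrite mulr_ge0 ?(ltW s0).
  have := ler_wpM2l es dd.
  move: (lu y); case: (eqVneq y z0) => [yz|yz]; last first.
    by rewrite [d y]/d (negbTE yz) !mulr0; lra.
  rewrite yz in lud *; rewrite [d z0]/d eqxx !mulr1 => _.
  (* At [z0] the time derivative costs [e] and the Laplacian of the correction at most [e t deg z0],
     because [s <= t]; the hypothesis on [e] pays for both. *)
  have : e * s * deg G z0 <= e * t * deg G z0.
    by rewrite ler_wpM2r ?deg_ge0 // ler_wpM2l.
  by move: he; rewrite mulrDr mulr1 mulrA; lra.
Qed.

End Comparison.

(** * Mean values and derivatives on the real line *)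

Lemma MVT_between (R : realType) (f df : R -> R) (s t : R) :
  (forall c : R, is_derive c 1 f (df c)) ->
  exists2 c, (s <= c <= t) || (t <= c <= s) & f t - f s = df c * (t - s).
Proof.
move=> hf.
have cf : continuous f by move=> c; exact: is_derive1_continuous (hf c).
have [st|/ltW ts] := leP s t.
  have [c] := MVT_segment st (fun x _ => hf x) (continuous_subspaceT cf).
  by rewrite in_itv /= => sct E; exists c => //; rewrite sct.
have [c] := MVT_segment ts (fun x _ => hf x) (continuous_subspaceT cf).
rewrite in_itv /= => tcs E; exists c; first by rewrite tcs orbT.
by rewrite -[LHS]opprB E -mulrN opprB.
Qed.

(** A quadratic Taylor bound passes to pointwise limits, so this differentiates the limit kernel
    without uniform convergence of derivatives. *)
Lemma is_derive1_quadratic (R : realType) (f : R -> R) (t d C : R) :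
  0 < t -> (forall s, 0 <= s -> `|f s - f t - (s - t) * d| <= C * (s - t) ^+ 2) ->
  is_derive t 1 f d.
Proof.
move=> t0 hC.
have C0 : 0 <= C.
  have := hC (t + 1); rewrite addr_ge0 ?(ltW t0) // => /(_ isT).
  by rewrite (_ : t + 1 - t = 1) ?expr1n ?mulr1; [apply: le_trans | ring].
have key : (h^-1 *: ((f \o shift t) (h *: (1 : R)) - f t)) @[h --> (0 : R)^'] --> d.
  apply/cvgrPdist_le => e e0; near=> h.
  have h0 : h != 0 by near: h; exact: nbhs_dnbhs_neq.
  have ht : `|h| < t by near: h; exact: dnbhs0_lt.
  have he : `|h| < e / (C + 1) by near: h; apply: dnbhs0_lt; rewrite divr_gt0 // ltr_wpDl.
  have th0 : 0 <= h + t by move: ht; rewrite ltr_norml => /andP[]; lra.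
  have := hC _ th0; rewrite addrK /= /shift /= /GRing.scale /= mulr1 => H.
  rewrite distrC (_ : h^-1 * _ - d = h^-1 * (f (h + t) - f t - h * d)); last first.
    by rewrite [RHS]mulrBr mulrA mulVf // mul1r.
  rewrite normrM normfV ler_pdivrMl ?normr_gt0 //.
  apply: (le_trans H); rewrite -[h ^+ 2]real_normK ?num_real // expr2 mulrCA.
  rewrite ler_wpM2l //.
  rewrite (@le_trans _ _ ((C + 1) * `|h|)) //; first by rewrite ler_wpM2r // lerDl.
  by move: he; rewrite ltr_pdivlMr ?ltr_wpDl // mulrC => /ltW.
apply: DeriveDef; first exact: cvgP key.
exact/cvg_lim.
Unshelve. all: by end_near. Qed.

(** * Combinatorial distance and balls *)

Section Distance.
Variables (R : realType) (V : countType) (G : graph R V).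
Implicit Types (x y z : V).

Lemma gdistP x y : has_walk G (gdist G x y) x y.
Proof. by rewrite /gdist; case: ex_minnP => n /asboolP. Qed.

Lemma gdist_min n x y : has_walk G n x y -> (gdist G x y <= n)%N.
Proof. by rewrite /gdist; case: ex_minnP => k _ h /asboolP /h. Qed.

Lemma adjC x y : adj G x y = adj G y x.
Proof. by rewrite /adj weightC. Qed.

Lemma has_walkS n x y z : has_walk G n x y -> adj G y z -> has_walk G n.+1 x z.
Proof.
move=> [s [<- ps ls]] yz; exists (rcons s z).
by rewrite size_rcons last_rcons rcons_path ps ls.
Qed.

Lemma gdistxx x : gdist G x x = 0%N.
Proof. by apply/eqP; rewrite -leqn0 gdist_min //; exists [::]. Qed.

Lemma gdist_eq0 x y : gdist G x y = 0%N -> y = x.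
Proof. by move=> h; have := gdistP x y; rewrite h => -[s [/size0nil ->]] _ <-. Qed.

Lemma gdist_adj x y z : adj G y z -> (gdist G x z <= (gdist G x y).+1)%N.
Proof. by move=> yz; apply: gdist_min; apply: has_walkS yz; exact: gdistP. Qed.

(** Take the last vertex but one of a shortest walk. *)
Lemma gdist_pred x z n : gdist G x z = n.+1 ->
  exists2 y, adj G y z & gdist G x y = n.
Proof.
move=> h; have [s [ss ps ls]] := gdistP x z; rewrite h in ss.
case/lastP: s => [//|s w] in ss ps ls *.
move: ss ps ls; rewrite size_rcons last_rcons rcons_path => -[ss] /andP[ps pw] wz.
rewrite wz in pw; exists (last x s) => //.
have dn : (gdist G x (last x s) <= n)%N by apply: gdist_min; exists s.
by apply/eqP; rewrite eqn_leq dn -ltnS -h; exact: gdist_adj.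
Qed.

Variable x0 : V.

(** Balls as duplicate-free lists, grown by adjoining neighbours, so that they can serve as the
    finite sets [B]. *)
Fixpoint gball (n : nat) : seq V :=
  if n is k.+1 then undup (gball k ++ flatten [seq nbr G x | x <- gball k])
  else [:: x0].

Lemma gball_uniq n : uniq (gball n).
Proof. by case: n => //= n; rewrite undup_uniq. Qed.

Lemma mem_gball n y : (y \in gball n) = (gdist G x0 y <= n)%N.
Proof.
elim: n y => [y|n IH y] /=.
  rewrite inE leqn0; apply/eqP/eqP => [->|/gdist_eq0 //]; exact: gdistxx.
rewrite mem_undup mem_cat IH; apply/orP/idP.
  case=> [/leqW //|/flatten_mapP[x]]; rewrite IH mem_nbr => xn xy.
  by apply: (leq_trans (gdist_adj x0 xy)); rewrite ltnS.
rewrite leq_eqVlt => /predU1P[/gdist_pred[x xy xn]|]; last by rewrite ltnS; left.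
by right; apply/flatten_mapP; exists x; rewrite ?IH ?xn // mem_nbr.
Qed.

Lemma gball_sub n k : (n <= k)%N -> {subset gball n <= gball k}.
Proof. by move=> nk y; rewrite !mem_gball => /leq_trans; apply. Qed.

Lemma near_gball y : \forall n \near \oo, y \in gball n.
Proof.
by near=> n; rewrite mem_gball; near: n; exact: nbhs_infty_ge.
Unshelve. all: by end_near. Qed.

Lemma near_gballs (A : seq V) : \forall n \near \oo, {subset A <= gball n}.
Proof.
elim: A => [|a A IH]; first by near=> n => ? //.
near=> n => y; rewrite inE => /predU1P[->|].
  by near: n; exact: near_gball.
by move: y; near: n.
Unshelve. all: by end_near. Qed.

End Distance.

(** * The minimal heat kernel *)

Section HeatKernel.
Variables (R : realType) (V : countType) (G : graph R V) (x0 : V).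
Implicit Types (x y z : V) (B : seq V) (f : V -> R) (s t : R).
Local Notation b := (weight G).
Local Notation m := (vmeas G).
Local Notation gball := (gball G x0).

(* The Laplacian with its minus sign flipped, which dominates every [dlap B]. *)
Definition alap f y : R := deg G y * f y + (m y)^-1 * \sum_(z <- nbr G y) b y z * f z.

Lemma alap_ge0 f y : (forall z, 0 <= f z) -> 0 <= alap f y.
Proof.
move=> f0; rewrite addr_ge0 ?(mulr_ge0 (deg_ge0 _ _)) ?(mulr_ge0 (vmeasV_ge0 _ _)) //.
by rewrite sumr_ge0 // => z _; rewrite mulr_ge0 ?weight_ge0.
Qed.

Lemma alapZ (a : R) f y : alap (fun z => f z * a) y = alap f y * a.
Proof.
rewrite /alap mulrDl -!mulrA mulr_suml; congr (_ + _ * _).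
by apply: eq_bigr => z _; rewrite mulrA.
Qed.

Lemma norm_dlap_le B f F y : uniq B -> (forall z, 0 <= F z) ->
  (forall z, `|f z| <= F z) -> `|dlap G B f y| <= alap F y.
Proof.
move=> uB F0 fF; rewrite (le_trans (ler_normB _ _)) // lerD //.
  by rewrite normrM (ger0_norm (deg_ge0 _ _)) ler_wpM2l ?deg_ge0.
rewrite normrM (ger0_norm (vmeasV_ge0 _ _)) ler_wpM2l ?vmeasV_ge0 //.
rewrite (le_trans (ler_norm_sum _ _ _)) //.
rewrite (@le_trans _ _ (\sum_(z <- B) b y z * F z)) //.
  by apply: ler_sum => z _; rewrite normrM (ger0_norm (weight_ge0 _ _ _)) ler_wpM2l ?weight_ge0.
apply: le_sum_uniq => // [|z _|z _ _]; first exact: nbr_uniq.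
  by rewrite mem_nbr negbK => /eqP ->; rewrite mul0r.
by rewrite mulr_ge0 ?weight_ge0.
Qed.

Lemma kern_le_vmeasV B x t y : uniq B -> 0 <= t -> kern G B x t y <= (m y)^-1.
Proof.
move=> uB t0; have [yB|yB] := boolP (y \in B); last by rewrite kern_out ?vmeasV_ge0.
rewrite -[leRHS]mul1r ler_pdivlMr ?vmeas_gt0 //.
apply: le_trans (mass_le1 G x uB t0); rewrite /mass (big_rem y) //= lerDl sumr_ge0 // => z _.
by rewrite mulr_ge0 ?kern_ge0 // ltW ?vmeas_gt0.
Qed.

(** Every Dirichlet kernel is at most [1 / m], so this bounds its time derivative at [y] for
    non-negative times, uniformly in [B] and in the source. *)
Definition lip y : R := alap (fun z => (m z)^-1) y.

Lemma lip_ge0 y : 0 <= lip y. Proof. by apply: alap_ge0 => z; exact: vmeasV_ge0. Qed.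

Lemma kern_lipschitz B x s t y : uniq B -> 0 <= s -> 0 <= t ->
  `|kern G B x t y - kern G B x s y| <= lip y * `|t - s|.
Proof.
move=> uB s0 t0; have [yB|yB] := boolP (y \in B); last first.
  by rewrite !kern_out // subrr normr0 mulr_ge0 ?lip_ge0.
have [c hc ->] := MVT_between s t (fun c => is_derive_kern G x c yB).
have c0 : 0 <= c by case/orP: hc => /andP[h _]; [exact: le_trans s0 h|exact: le_trans t0 h].
rewrite normrM ler_wpM2r // normrN; apply: norm_dlap_le => // z.
  exact: vmeasV_ge0.
by rewrite ger0_norm ?kern_ge0 // kern_le_vmeasV.
Qed.

(** The mean value theorem writes the remainder as [dlap] of a kernel increment, which the Lipschitz
    bound controls. The constant does not involve [B], so the estimate survives the exhaustion. *)
Lemma kern_taylor B x s t y : uniq B -> 0 <= s -> 0 <= t -> y \in B ->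
  `|kern G B x t y - kern G B x s y + (t - s) * dlap G B (kern G B x s) y|
    <= alap lip y * (t - s) ^+ 2.
Proof.
move=> uB s0 t0 yB.
have [c hc ->] := MVT_between s t (fun c => is_derive_kern G x c yB).
have c0 : 0 <= c by case/orP: hc => /andP[h _]; [exact: le_trans s0 h|exact: le_trans t0 h].
have cs : `|s - c| <= `|t - s|.
  case/orP: hc => /andP[h1 h2].
    by rewrite distrC !ger0_norm ?subr_ge0 ?lerB //; exact: le_trans h2.
  by rewrite [leRHS]distrC !ger0_norm ?subr_ge0 ?lerB //; exact: le_trans h2.
rewrite (_ : _ + _ = (t - s) * dlap G B (fun z => 1 * kern G B x s z + (-1) * kern G B x c z) y).
  rewrite normrM -real_normK ?num_real // expr2 mulrCA ler_wpM2l //.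
  rewrite -alapZ; apply: norm_dlap_le => // z; first by rewrite mulr_ge0 ?lip_ge0.
  rewrite mul1r mulN1r; apply: (le_trans (kern_lipschitz x z uB c0 s0)).
  by rewrite ler_wpM2l ?lip_ge0.
by rewrite dlap_linear; ring.
Qed.

(** The exhaustion is by balls about the fixed vertex [x0], whatever the source [x]. *)
Definition hk t x y : R := limn (fun n => kern G (gball n) x t y).

Lemma kern_ball_nd x t y : 0 <= t ->
  {homo (fun n => kern G (gball n) x t y) : n k / (n <= k)%N >-> n <= k}.
Proof. by move=> t0 n k nk; apply: le_kern; rewrite ?gball_uniq //; exact: gball_sub. Qed.

Lemma is_cvg_hk x t y : 0 <= t -> cvgn (fun n => kern G (gball n) x t y).
Proof.
move=> t0; apply: nondecreasing_is_cvgn; first exact: kern_ball_nd.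
by exists (m y)^-1 => _ [n _ <-]; rewrite kern_le_vmeasV ?gball_uniq.
Qed.

Lemma kern_le_hk n x t y : 0 <= t -> kern G (gball n) x t y <= hk t x y.
Proof.
move=> t0; apply: (@nondecreasing_cvgn_le _ (fun n => kern G (gball n) x t y)).
  exact: kern_ball_nd.
exact: is_cvg_hk.
Qed.

Lemma hk_ge0 t x y : 0 <= t -> 0 <= hk t x y.
Proof. by move=> t0; apply: le_trans (kern_le_hk 0 x y t0); exact: kern_ge0. Qed.

(** Once the ball contains all neighbours of [y], [dlap] is the full Laplacian, a finite sum in
    which limits may be taken. *)
Lemma cvg_dlap_hk x t y : 0 <= t ->
  dlap G (gball n) (kern G (gball n) x t) y @[n --> \oo] --> laplacian G (hk t x) y.
Proof.
move=> t0; apply: cvg_trans.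
  apply: (@near_eq_cvg _ _ _ _ (fun n => laplacian G (kern G (gball n) x t) y)).
  near=> n; apply: laplacian_dlap; first exact: gball_uniq.
  have sub : {subset nbr G y <= gball n} by near: n; exact: near_gballs.
  by move=> z; rewrite -mem_nbr => /sub.
rewrite (laplacianE G (hk t x) y).
rewrite (_ : (fun n => laplacian G _ y) = (fun n => deg G y * kern G (gball n) x t y -
   (m y)^-1 * \sum_(z <- nbr G y) b y z * kern G (gball n) x t z)); last first.
  by apply/funext => n; rewrite laplacianE.
apply: cvgB; first by apply: cvgMr; exact: is_cvg_hk.
apply: cvgMr; apply: cvg_sum_seq => z _.
by apply: cvgMr; exact: is_cvg_hk.
Unshelve. all: by end_near. Qed.

Lemma hk_taylor x s t y : 0 <= s -> 0 <= t ->
  `|hk t x y - hk s x y + (t - s) * laplacian G (hk s x) y| <= alap lip y * (t - s) ^+ 2.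
Proof.
move=> s0 t0.
have cv : `|kern G (gball n) x t y - kern G (gball n) x s y
      + (t - s) * dlap G (gball n) (kern G (gball n) x s) y| @[n --> \oo]
    --> `|hk t x y - hk s x y + (t - s) * laplacian G (hk s x) y|.
  apply: cvg_norm; apply: cvgD; last by apply: cvgMr; exact: cvg_dlap_hk.
  by apply: cvgB; exact: is_cvg_hk.
apply: (ler_cvg_to cv (cvg_cst _)); near=> n.
apply: kern_taylor => //; first exact: gball_uniq.
by near: n; exact: near_gball.
Unshelve. all: by end_near. Qed.

Lemma hk_lipschitz x s t y : 0 <= s -> 0 <= t ->
  `|hk t x y - hk s x y| <= lip y * `|t - s|.
Proof.
move=> s0 t0.
have cv : `|kern G (gball n) x t y - kern G (gball n) x s y| @[n --> \oo]
    --> `|hk t x y - hk s x y|.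
  by apply: cvg_norm; apply: cvgB; exact: is_cvg_hk.
apply: (ler_cvg_to cv (cvg_cst _)); near=> n.
by apply: kern_lipschitz => //; exact: gball_uniq.
Unshelve. all: by end_near. Qed.

Lemma hk0 x y : hk 0 x y = (y == x)%:R / m x.
Proof.
apply/cvg_lim => //; apply: cvg_near_cst; near=> n; rewrite kern_at0 //.
by near: n; exact: near_gball.
Unshelve. all: by end_near. Qed.

Lemma heat_solution_hk x : heat_solution G x (fun t => hk t x).
Proof.
split=> [t y|y|y|t y t0]; first exact: hk_ge0.
- exact: hk0.
- apply/cvgrPdist_le => e e0; near=> t.
  have t0 : 0 <= t by apply: ltW; near: t; exact: nbhs_right_gt.
  rewrite distrC; apply: (le_trans (hk_lipschitz x y (lexx 0) t0)).
  (* The [+ 1] makes the constant positive, so that it can be divided by. *)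
  rewrite subr0 ger0_norm // (@le_trans _ _ ((lip y + 1) * t)) //.
    by rewrite ler_wpM2r // lerDl.
  rewrite mulrC -ler_pdivlMr ?ltr_wpDl ?lip_ge0 //.
  apply: ltW; near: t; apply: nbhs_right_lt; rewrite divr_gt0 // ltr_wpDl ?lip_ge0 //.
- have dq : is_derive t 1 (fun s => hk s x y) (- laplacian G (hk t x) y).
    apply: (@is_derive1_quadratic _ _ _ _ (alap lip y)) => // s s0.
    by rewrite mulrN opprK; apply: hk_taylor => //; exact: ltW.
  split; first exact: (@ex_derive _ _ _ _ _ _ _ dq).
  by rewrite derive1E (@derive_val _ _ _ _ _ _ _ dq) addNr.
Unshelve. all: by end_near. Qed.

Lemma heat_kernel_hk : heat_kernel G hk.
Proof.
move=> x; split; first exact: heat_solution_hk.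
move=> q hq t y t0; apply: limr_le; first exact: is_cvg_hk.
by near=> n; apply: kern_le_heat_solution => //; exact: gball_uniq.
Unshelve. all: by end_near. Qed.

End HeatKernel.

(** * Unordered sums as suprema of finite sums *)

Section EsumSeq.
Variables (R : realType) (T : choiceType).
Implicit Types (a : T -> R) (s : seq T).

Lemma sum_le_esum a s : uniq s ->
  ((\sum_(y <- s) a y)%:E <= \esum_(y in [set: T]) (a y)%:E)%E.
Proof.
move=> us; apply: esum_ge; exists [set` s].
  by split => //; exact: finite_seq.
by rewrite -fsbig_seq // sumEFin.
Qed.

Lemma esum_le_sum a (M : R) : (forall s, uniq s -> \sum_(y <- s) a y <= M) ->
  (\esum_(y in [set: T]) (a y)%:E <= M%:E)%E.
Proof.
move=> h; apply: ge_ereal_sup => _ [X [fX _] <-].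
by rewrite fsbig_finite //= sumEFin lee_fin h.
Qed.

Lemma lt_esum_sum a (l : R) : (l%:E < \esum_(y in [set: T]) (a y)%:E)%E ->
  exists2 s, uniq s & l < \sum_(y <- s) a y.
Proof.
move=> h; apply: contrapT => /forall2NP H.
move: h; apply/negP; rewrite -leNgt; apply: esum_le_sum => s us.
by have [//|/negP] := H s; rewrite -leNgt.
Qed.

End EsumSeq.

(** * Stochastic completeness implies the Liouville property *)

Section StochasticCompleteness.
Variables (R : realType) (V : countType) (G : graph R V) (x0 : V).
Implicit Types (x y z : V) (u v : V -> R) (t : R).
Local Notation b := (weight G).
Local Notation m := (vmeas G).
Local Notation gball := (gball G x0).
Local Notation hk := (hk G x0).

Lemma sum_kern_le_mass (A B : seq V) z t : uniq A -> uniq B -> {subset A <= B} ->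
  0 <= t -> \sum_(y <- A) kern G B z t y * m y <= mass G B z t.
Proof.
move=> uA uB AB t0; apply: le_sum_uniq => // y; first by move=> /AB ->.
by move=> _ _; rewrite mulr_ge0 ?kern_ge0 // ltW ?vmeas_gt0.
Qed.

Lemma cvg_sum_hk (A : seq V) z t : 0 <= t ->
  \sum_(y <- A) kern G (gball n) z t y * m y @[n --> \oo] --> \sum_(y <- A) hk t z y * m y.
Proof.
move=> t0; apply: cvg_sum_seq => y _.
by apply: cvgMl; exact: is_cvg_hk.
Qed.

Lemma stochastically_complete_mass : stochastically_complete G ->
  forall z t, 0 < t -> mass G (gball n) z t @[n --> \oo] --> (1 : R).
Proof.
move=> [p [hp p1]] z t t0; have t0' := ltW t0.
apply/cvgrPdist_le => e e0.
have [|s us hs] := @lt_esum_sum _ _ (fun y => p t z y * m y) (1 - e).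
  by rewrite p1 // lte_fin gtrBl.
(* Minimality gives [p <= hk], so the finite list [s] carries mass above [1 - e] for [hk] as well,
   and then for the kernels of large balls. *)
have {}hs : 1 - e < \sum_(y <- s) hk t z y * m y.
  apply: (lt_le_trans hs); apply: ler_sum => y _.
  rewrite ler_wpM2r ?(ltW (vmeas_gt0 _ _)) //.
  by apply: ((hp z).2 (fun t => hk t z)) => //; exact: heat_solution_hk.
near=> n.
have un := gball_uniq G x0 n.
rewrite ger0_norm ?subr_ge0 ?mass_le1 // lerBlDr -lerBlDl.
apply: le_trans (sum_kern_le_mass z us un _ t0').
  by apply: ltW; near: n; exact: (cvgr_gt _ (cvg_sum_hk t0') _ hs).
by near: n; exact: near_gballs.
Unshelve. all: by end_near. Qed.

(** Each [mass] bounds the total mass of [hk] from below; the upper bound [1] passes to the limit on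
    finite sets. *)
Lemma mass_stochastically_complete :
  (forall z t (e : R), 0 < t -> 0 < e -> exists n, 1 - e <= mass G (gball n) z t) ->
  stochastically_complete G.
Proof.
move=> h; exists hk; split; first exact: heat_kernel_hk.
move=> x t t0; have t0' := ltW t0; apply/eqP; rewrite eq_le; apply/andP; split.
  apply: esum_le_sum => s us.
  apply: (ler_cvg_to (cvg_sum_hk t0') (cvg_cst _)); near=> n.
  apply: le_trans (mass_le1 G x (gball_uniq G x0 n) t0').
  apply: sum_kern_le_mass => //; first exact: gball_uniq.
  by near: n; exact: near_gballs.
apply/lee_addgt0Pr => e e0; have [n hn] := h x t e t0 e0.
rewrite -leeBlDr // -EFinB.
apply: (@le_trans _ _ (\sum_(y <- gball n) hk t x y * m y)%:E).
  rewrite lee_fin (le_trans hn) //; apply: ler_sum => y _.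
  by rewrite ler_wpM2r ?(ltW (vmeas_gt0 _ _)) // kern_le_hk.
apply: sum_le_esum; exact: gball_uniq.
Unshelve. all: by end_near. Qed.

(** Sum [kern_superharmonic] against [m]; symmetry of the kernel moves it from [u] onto the constant
    [1]. *)
Lemma defect_ge (B : seq V) z0 t u (e : R) : uniq B -> z0 \in B -> 0 < t ->
  (forall y, 0 <= u y) -> (forall y, 0 <= laplacian G u y) ->
  0 <= e -> e * (1 + t * deg G z0) <= laplacian G u z0 ->
  m z0 * (e * t) <= \sum_(z <- B) m z * u z * (1 - mass G B z t).
Proof.
move=> uB zB t0 u0 lu e0 he.
have -> : \sum_(z <- B) m z * u z * (1 - mass G B z t) =
    \sum_(z <- B) m z * (u z - \sum_(y <- B) kern G B z t y * m y * u y).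
  transitivity (\sum_(z <- B) m z * u z
      - \sum_(z <- B) \sum_(y <- B) m z * u z * (kern G B z t y * m y)).
    rewrite -sumrB; apply: eq_bigr => z _.
    by rewrite mulrBr mulr1 /mass mulr_sumr.
  rewrite exchange_big /= -sumrB; apply: eq_bigr => z _.
  rewrite mulrBr mulr_sumr; congr (_ - _); apply: eq_bigr => y _.
  by rewrite (kernC G y z uB (ltW t0)); ring.
rewrite (@le_trans _ _ (\sum_(z <- B) m z * (e * t * (z == z0)%:R))) //.
  rewrite (bigD1_seq z0) //= eqxx mulr1 lerDl sumr_ge0 // => z _.
  by rewrite !mulr_ge0 ?(ltW (vmeas_gt0 _ _)) ?(ltW t0) ?ler0n.
rewrite big_seq [leRHS]big_seq; apply: ler_sum => z zB'.
rewrite ler_wpM2l ?(ltW (vmeas_gt0 _ _)) //.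
by have := kern_superharmonic uB zB' t0 u0 lu e0 he; lra.
Qed.

Lemma superharmonic_L1_harmonic u : stochastically_complete G ->
  (forall x, 0 <= u x) -> L1 G u -> (forall x, 0 <= laplacian G u x) ->
  forall x, laplacian G u x = 0.
Proof.
move=> SC u0 uL1 lu z0; apply/eqP; rewrite eq_le lu andbT leNgt; apply/negP => lpos.
(* The largest [e] that [defect_ge] allows at time [t = 1]. *)
pose e := laplacian G u z0 / (1 + 1 * deg G z0).
have den : 0 < 1 + 1 * deg G z0 by rewrite mul1r ltr_pwDl ?deg_ge0.
have e0 : 0 < e by rewrite divr_gt0.
(* A third of the lower bound for the defect: the sums over [A] and over its complement will each
   stay below [d]. *)
pose d := m z0 * (e * 1) / 3.
have d0 : 0 < d by rewrite divr_gt0 // mulr_gt0 ?vmeas_gt0 // mulr1.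
pose a x := `|u x| * m x.
have aE x : a x = m x * u x by rewrite /a ger0_norm // mulrC.
have a0 x : 0 <= a x by rewrite mulr_ge0 ?(ltW (vmeas_gt0 _ _)).
pose M := fine (\esum_(x in [set: V]) (a x)%:E).
have ME : (\esum_(x in [set: V]) (a x)%:E = M%:E)%E.
  rewrite fineK // ge0_fin_numE //; apply: esum_ge0 => x _.
  by rewrite lee_fin.
have [|A uA hA] := @lt_esum_sum _ _ a (M - d).
  by rewrite ME lte_fin gtrBl.
have smallA : \sum_(z <- A) a z * (1 - mass G (gball n) z 1) @[n --> \oo]
    --> \sum_(z <- A) a z * (1 - 1).
  apply: cvg_sum_seq => z _; apply: cvgMr; apply: cvgB; first exact: cvg_cst.
  exact: stochastically_complete_mass.
rewrite [X in _ --> X]big1 in smallA; last by move=> z _; rewrite subrr mulr0.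
have [n [zn An sn]] : exists n, [/\ z0 \in gball n, {subset A <= gball n} &
    \sum_(z <- A) a z * (1 - mass G (gball n) z 1) < d].
  have : \forall n \near \oo, [/\ z0 \in gball n, {subset A <= gball n} &
      \sum_(z <- A) a z * (1 - mass G (gball n) z 1) < d].
    near=> n; split; near: n; first exact: near_gball.
      exact: near_gballs.
    exact: (cvgr_lt _ smallA _ d0).
  by move=> [N _ /(_ N (leqnn _)) hN]; exists N.
have un := gball_uniq G x0 n.
have he : e * (1 + 1 * deg G z0) <= laplacian G u z0 by rewrite divfK // gt_eqF.
have := defect_ge un zn ltr01 u0 lu (ltW e0) he.
rewrite (_ : m z0 * (e * 1) = 3 * d); last by rewrite /d; field.
under eq_bigr => z _ do rewrite -aE.
rewrite (bigID (fun z => z \in A)) /=.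
have splitA F : \sum_(z <- gball n | z \in A) F z = \sum_(z <- A) F z :> R.
  rewrite -big_filter; apply: perm_big; apply: uniq_perm => //.
    by rewrite filter_uniq.
  by move=> z; rewrite mem_filter; case: (boolP (z \in A)) => //= /An ->.
rewrite splitA.
(* Off [A] the factor [1 - mass] is at most [1], and [A] leaves out less than [d] of the norm of
   [u]. *)
have : \sum_(z <- gball n | z \notin A) a z * (1 - mass G (gball n) z 1) <=
       \sum_(z <- gball n | z \notin A) a z.
  apply: ler_sum => z _; rewrite -[leRHS]mulr1 ler_wpM2l // lerBlDr lerDl.
  by rewrite sumr_ge0 // => y _; rewrite mulr_ge0 ?kern_ge0 // ltW ?vmeas_gt0.
have : \sum_(z <- gball n) a z <= M.
  by rewrite -lee_fin -ME; exact: sum_le_esum.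
rewrite (bigID (fun z => z \in A)) /= splitA.
by move: hA sn d0; lra.
Unshelve. all: by end_near. Qed.

(** Where [u y <= c], truncation only lowers the neighbouring values; elsewhere the truncated
    function is maximal at [y]. *)
Lemma laplacian_minr_ge0 u (c : R) y : 0 <= laplacian G u y ->
  0 <= laplacian G (fun z => Num.min (u z) c) y.
Proof.
rewrite !laplacian_nbr => lu.
have [uc|/ltW cu] := leP (u y) c.
  apply: (le_trans lu); rewrite ler_wpM2l ?vmeasV_ge0 //; apply: ler_sum => z _.
  by rewrite ler_wpM2l ?weight_ge0 // lerB // ge_min lexx.
rewrite mulr_ge0 ?vmeasV_ge0 // sumr_ge0 // => z _.
by rewrite mulr_ge0 ?weight_ge0 // subr_ge0 ge_min lexx orbT.
Qed.

Lemma stochastically_complete_L1_Liouville :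
  stochastically_complete G -> L1_Liouville G.
Proof.
move=> SC u u0 uL1 lu; exists (u x0).
have step_ge x y : adj G x y -> u x <= u y.
  (* The truncation at height [u x] is harmonic and maximal at [x], hence equal to [u x] at every
     neighbour, which forces [u x <= u y]. *)
  move=> xy; pose w z := Num.min (u z) (u x).
  have w0 z : 0 <= w z by rewrite le_min !u0.
  have wL1 : L1 G w.
    apply: le_lt_trans uL1; apply: le_esum => z _; rewrite lee_fin.
    rewrite ler_wpM2r ?(ltW (vmeas_gt0 _ _)) // !ger0_norm //.
    by rewrite ge_min lexx.
  have lw z : 0 <= laplacian G w z by exact: laplacian_minr_ge0.
  have := superharmonic_L1_harmonic SC w0 wL1 lw x.
  move/eqP; rewrite laplacian_nbr mulf_eq0 invr_eq0 (negbTE (vmeas_neq0 _ _)) /=.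
  have wx z : w z <= w x by rewrite /w minxx ge_min lexx orbT.
  rewrite psumr_eq0 => [/allP /(_ y)|z _]; last by rewrite mulr_ge0 ?weight_ge0 ?subr_ge0.
  rewrite mem_nbr => /(_ xy) /=; rewrite mulf_eq0 (negbTE xy) /= subr_eq0 => /eqP.
  by rewrite /w minxx => ->; rewrite ge_min lexx.
move=> x; have [s [ps <-]] := graph_connected G x0 x.
elim: s x0 ps => //= z s IH y /andP[yz /IH ->].
by apply/eqP; rewrite eq_le !step_ge // adjC.
Qed.

End StochasticCompleteness.

(** * Model graphs *)

Section ModelGraph.
Variables (R : realType) (V : countType) (G : graph R V) (x0 : V).
Implicit Types (x y z : V) (t : R) (phi c : nat -> R).
Local Notation b := (weight G).
Local Notation m := (vmeas G).
Local Notation gball := (gball G x0).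
Local Notation dist := (gdist G x0).

Definition sph r := [seq y <- gball r | dist y == r].

Lemma mem_sph r y : (y \in sph r) = (dist y == r).
Proof. by rewrite mem_filter mem_gball; case: eqP => // ->; rewrite leqnn. Qed.

Lemma sph_uniq r : uniq (sph r).
Proof. by rewrite filter_uniq // gball_uniq. Qed.

Lemma sum_gball0 (F : V -> R) : \sum_(y <- gball 0) F y = \sum_(y <- sph 0) F y.
Proof. by rewrite /sph /= gdistxx eqxx. Qed.

Lemma sum_gballS n (F : V -> R) :
  \sum_(y <- gball n.+1) F y = \sum_(y <- gball n) F y + \sum_(y <- sph n.+1) F y.
Proof.
rewrite (bigID (fun y => dist y <= n)%N) -!(big_filter (gball n.+1)).
congr (_ + _); apply: perm_big; apply: uniq_perm; rewrite ?filter_uniq ?gball_uniq ?sph_uniq //.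
  by move=> y; rewrite mem_filter !mem_gball; case: leqP => //= h; rewrite leqW.
by move=> y; rewrite mem_filter mem_sph mem_gball -ltnNge eqn_leq andbC.
Qed.

Definition sphere_meas r := \sum_(y <- sph r) m y.
Definition vol r := \sum_(y <- gball r) m y.
Definition boundary r := \sum_(x <- sph r) \sum_(y <- sph r.+1) b x y.

Lemma vol0 : vol 0 = sphere_meas 0. Proof. exact: sum_gball0. Qed.

Lemma volS r : vol r.+1 = vol r + sphere_meas r.+1. Proof. exact: sum_gballS. Qed.

Lemma sphere_meas_ge0 r : 0 <= sphere_meas r.
Proof. by rewrite sumr_ge0 // => y _; rewrite ltW ?vmeas_gt0. Qed.

Lemma sphere_meas_gt0 x : 0 < sphere_meas (dist x).
Proof.
rewrite /sphere_meas (big_rem x) ?mem_sph ?eqxx //= ltr_pwDl ?vmeas_gt0 //.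
by rewrite sumr_ge0 // => y _; rewrite ltW ?vmeas_gt0.
Qed.

Lemma le_vol r s : (r <= s)%N -> vol r <= vol s.
Proof.
move=> rs; apply: (homo_leq (r := fun a b : R => a <= b)) rs => //; first exact: le_trans.
by move=> k; rewrite volS lerDl sphere_meas_ge0.
Qed.

Lemma vol_gt0 r : 0 < vol r.
Proof.
apply: lt_le_trans (le_vol (leq0n r)); rewrite vol0 -[X in sphere_meas X](gdistxx G x0).
exact: sphere_meas_gt0.
Qed.

Lemma boundary_ge0 r : 0 <= boundary r.
Proof. by rewrite sumr_ge0 // => x _; rewrite sumr_ge0 // => y _; exact: weight_ge0. Qed.

Lemma boundary_gt0 r y : dist y = r.+1 -> 0 < boundary r.
Proof.
move=> yr; have [x xy xr] := gdist_pred yr.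
rewrite /boundary (big_rem x) ?mem_sph ?xr //= (big_rem y) ?mem_sph ?yr //=.
rewrite -addrA ltr_pwDl //.
  by rewrite lt_neqAle weight_ge0 andbT eq_sym.
rewrite addr_ge0 ?sumr_ge0 // => [z _|z _]; first exact: weight_ge0.
by rewrite sumr_ge0 // => w _; exact: weight_ge0.
Qed.

(** Descending towards [x0] from a vertex outside the ball would reach the sphere of radius [r.+1],
    and then [boundary r > 0]. *)
Lemma boundary_eq0_finite r y : boundary r = 0 -> y \in gball r.
Proof.
move=> D0; rewrite mem_gball leqNgt; apply/negP => ry.
have [k yk] : exists k, dist y = (r + k).+1.
  by exists (dist y - r.+1)%N; rewrite -addSn subnKC.
elim: k y ry yk => [|k IH] y ry yk.
  by have := boundary_gt0 (etrans yk (congr1 S (addn0 r))); rewrite D0 ltxx.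
have [z _ zk] := gdist_pred yk.
by apply: (IH z); rewrite zk addnS ?ltnS ?leq_addr.
Qed.

(** Neighbours lie at distance [r - 1], [r] or [r + 1], and those at distance [r] contribute
    nothing. For [r = 0] the default [r.-1 = 0] is harmless: the inner sum is empty. *)
Lemma laplacian_radial phi x r : dist x = r ->
  laplacian G (fun y => phi (dist y)) x =
  (m x)^-1 * ((phi r - phi r.+1) * \sum_(y <- sph r.+1) b x y
    + (phi r - phi r.-1) * \sum_(y <- gball r | (dist y).+1 == r) b x y).
Proof.
move=> xr; rewrite laplacian_nbr xr; congr (_ * _).
rewrite (eq_big_seq (fun y => (phi r - phi r.+1) * (if dist y == r.+1 then b x y else 0)
   + (phi r - phi r.-1) * (if (dist y).+1 == r then b x y else 0))); last first.
  move=> y; rewrite mem_nbr => xy.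
  have := gdist_adj x0 xy; rewrite xr => le1.
  have : (r <= (dist y).+1)%N by rewrite -xr gdist_adj // adjC.
  case: (ltngtP (dist y).+1 r) => // [lt2|eq2] _; last first.
    by rewrite -eq2 /= [dist y == _]ltn_eqF // mulr0 add0r mulrC.
  move: lt2; rewrite ltnS leq_eqVlt => /predU1P[->|lt3].
    by rewrite subrr mulr0 ltn_eqF // !mulr0 addr0.
  have -> : dist y = r.+1 by apply/eqP; rewrite eqn_leq le1.
  by rewrite eqxx mulr0 addr0 mulrC.
rewrite big_split /= -!mulr_sumr -!big_mkcond /=.
congr (_ * _ + _ * _); rewrite -big_filter.
  apply: eq_sum_uniq => [||y xy]; rewrite ?filter_uniq ?nbr_uniq ?gball_uniq //.
  by rewrite mem_filter mem_nbr xy andbT mem_sph.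
rewrite -[RHS]big_filter; apply: eq_sum_uniq => [||y xy].
- by rewrite filter_uniq ?nbr_uniq.
- by rewrite filter_uniq ?gball_uniq.
by rewrite !mem_filter mem_nbr xy mem_gball; case: eqP => //= <-; rewrite leqnSn.
Qed.

Lemma sum_inner x r :
  \sum_(y <- gball r.+1 | (dist y).+1 == r.+1) b x y = \sum_(y <- sph r) b x y.
Proof.
rewrite -big_filter; apply: eq_sum_uniq; rewrite ?filter_uniq ?gball_uniq //.
move=> y _; rewrite mem_filter mem_sph mem_gball eqSS; case: eqP => //= ->.
exact: leqnSn.
Qed.

Lemma outer_curvatureE x r : dist x = r ->
  outer_curvature G x0 x = (m x)^-1 * \sum_(y <- sph r.+1) b x y.
Proof.
move=> xr; rewrite /outer_curvature xr.
rewrite (_ : sphere G x0 r.+1 = [set` sph r.+1]); first by rewrite -fsbig_seq ?sph_uniq.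
by apply/seteqP; split => y /=; rewrite mem_sph => /eqP.
Qed.

Lemma inner_curvatureE x r : dist x = r.+1 ->
  inner_curvature G x0 x = (m x)^-1 * \sum_(y <- sph r) b x y.
Proof.
move=> xr; rewrite /inner_curvature xr.
rewrite (_ : [set y | _] = [set` sph r]); first by rewrite -fsbig_seq ?sph_uniq.
by apply/seteqP; split => y /=; rewrite mem_sph; [move=> [->] | move=> /eqP ->].
Qed.

Hypothesis hG : model_graph G x0.

(** Constant outer curvature means that each vertex of the sphere carries a share of [boundary r]
    proportional to its measure. *)
Lemma outer_balance x r : dist x = r ->
  (\sum_(y <- sph r.+1) b x y) * sphere_meas r = m x * boundary r.
Proof.
move=> xr; have E z : z \in sph r ->
    \sum_(y <- sph r.+1) b z y = m z * outer_curvature G x0 x.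
  rewrite mem_sph => /eqP zr; rewrite -((hG zr xr).1) (outer_curvatureE zr).
  by rewrite mulrA divff ?mul1r ?vmeas_neq0.
rewrite E ?mem_sph ?xr // /boundary (eq_big_seq _ E) -mulr_suml /sphere_meas.
by rewrite -mulrA [outer_curvature _ _ _ * _]mulrC.
Qed.

(** The same share seen from the outer side of the boundary, by symmetry of [b]. *)
Lemma inner_balance x r : dist x = r.+1 ->
  (\sum_(y <- sph r) b x y) * sphere_meas r.+1 = m x * boundary r.
Proof.
move=> xr; have E z : z \in sph r.+1 ->
    \sum_(y <- sph r) b y z = m z * inner_curvature G x0 x.
  rewrite mem_sph => /eqP zr; rewrite -((hG zr xr).2) (inner_curvatureE zr).
  rewrite mulrA divff ?mul1r ?vmeas_neq0 //; apply: eq_bigr => y _; exact: weightC.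
under eq_bigr do rewrite weightC.
rewrite E ?mem_sph ?xr // /boundary exchange_big /= (eq_big_seq _ E) -mulr_suml /sphere_meas.
by rewrite -mulrA [inner_curvature _ _ _ * _]mulrC.
Qed.

(* [c r] is the flux of [phi] across the boundary of the ball of radius [r]. *)
Lemma laplacian_flux0 phi c : (forall r, (phi r - phi r.+1) * boundary r = c r) ->
  forall x, dist x = 0%N ->
  sphere_meas 0 * laplacian G (fun y => phi (dist y)) x = c 0%N.
Proof.
move=> hc x xr; rewrite (laplacian_radial _ xr) subrr mul0r addr0 -hc.
rewrite (_ : sphere_meas 0 * _ = (m x)^-1 * (phi 0%N - phi 1%N)
  * ((\sum_(y <- sph 1) b x y) * sphere_meas 0)); last by ring.
by rewrite (outer_balance xr); field; exact: vmeas_neq0.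
Qed.

(** Flux out through the outer boundary minus flux in through the inner one, spread over the sphere
    in proportion to [m]. *)
Lemma laplacian_fluxS phi c : (forall r, (phi r - phi r.+1) * boundary r = c r) ->
  forall x r, dist x = r.+1 ->
  sphere_meas r.+1 * laplacian G (fun y => phi (dist y)) x = c r.+1 - c r.
Proof.
move=> hc x r xr; rewrite (laplacian_radial _ xr) sum_inner /= -!hc.
rewrite (_ : sphere_meas r.+1 * _ = (m x)^-1 *
  ((phi r.+1 - phi r.+2) * ((\sum_(y <- sph r.+2) b x y) * sphere_meas r.+1)
  + (phi r.+1 - phi r) * ((\sum_(y <- sph r) b x y) * sphere_meas r.+1))); last by ring.
rewrite (outer_balance xr) (inner_balance xr).
by field; exact: vmeas_neq0.
Qed.

(** The ball of radius [r] is the whole graph, so the condition off [B] is vacuous and [v = 0]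
    serves in [mass_ge]; [c = t / e] makes the defect [e]. *)
Lemma finite_stochastically_complete r : boundary r = 0 -> stochastically_complete G.
Proof.
move=> D0; apply: (@mass_stochastically_complete _ _ _ x0) => z t e t0 e0; exists r.
have := @mass_ge _ _ G (gball r) z t (fun=> 0) (t / e).
rewrite add0r invfM invrK mulrA divff ?gt_eqF // mul1r; apply => //.
- exact: gball_uniq.
- exact: boundary_eq0_finite.
- by rewrite divr_gt0.
- by move=> y; rewrite boundary_eq0_finite.
- move=> y _; rewrite laplacian_nbr big1 ?mulr0 ?lerN10 // => w _.
  by rewrite subrr mulr0.
Qed.

Definition vol_ratio n : R := \sum_(0 <= k < n) vol k / boundary k.

Lemma vol_ratioS n : vol_ratio n.+1 = vol_ratio n + vol n / boundary n.
Proof. by rewrite /vol_ratio big_nat_recr. Qed.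

Lemma le_vol_ratio n k : (n <= k)%N -> vol_ratio n <= vol_ratio k.
Proof.
move=> nk; apply: (homo_leq (r := fun a b : R => a <= b)) nk => //; first exact: le_trans.
move=> j; rewrite vol_ratioS lerDl divr_ge0 ?boundary_ge0 //; exact/ltW/vol_gt0.
Qed.

Lemma vol_ratio_ge0 n : 0 <= vol_ratio n.
Proof.
by apply: le_trans (le_vol_ratio (leq0n n)); rewrite /vol_ratio big_nil.
Qed.

Lemma unbounded_stochastically_complete : (forall r, 0 < boundary r) ->
  (forall M, exists n, M < vol_ratio n) -> stochastically_complete G.
Proof.
move=> D0 unb; apply: (@mass_stochastically_complete _ _ _ x0) => z t e t0 e0.
pose v y := vol_ratio (dist y).
have v0 y : 0 <= v y by exact: vol_ratio_ge0.
have vt : 0 < v z + t by rewrite ltr_wpDl.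
(* With [c = (v z + t) / e] the defect in [mass_ge] is exactly [e]; the radius must make [v >= c]
   outside the ball and [z] lie inside. *)
have [n hn] := unb ((v z + t) / e); exists (maxn n (dist z)).
have := @mass_ge _ _ G (gball (maxn n (dist z))) z t v ((v z + t) / e).
rewrite invfM invrK mulrA divff ?gt_eqF // mul1r; apply => //.
- exact: gball_uniq.
- by rewrite mem_gball leq_maxr.
- by rewrite divr_gt0.
- move=> y; rewrite mem_gball -ltnNge gtn_max => /andP[ny _].
  by apply: (le_trans (ltW hn)); apply: le_vol_ratio; exact: ltnW.
(* The flux [- vol r] drops by the measure of each sphere crossed, so the Laplacian of [v] is
   [-1]. *)
have flux r : (vol_ratio r - vol_ratio r.+1) * boundary r = - vol r.
  by rewrite vol_ratioS; field; rewrite gt_eqF.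
move=> y _; case E : (dist y) => [|r]; have := sphere_meas_gt0 y; rewrite E => s0.
  by rewrite -(ler_pM2l s0) (laplacian_flux0 flux E) vol0 mulrN1.
by rewrite -(ler_pM2l s0) (laplacian_fluxS flux E) volS mulrN1; lra.
Qed.

Lemma bounded_not_L1_Liouville M : (forall r, 0 < boundary r) ->
  (forall n, vol_ratio n <= M) -> ~ L1_Liouville G.
Proof.
move=> D0 hM liou.
pose T n : R := \sum_(0 <= k < n) (boundary k)^-1.
have TS n : T n.+1 = T n + (boundary n)^-1 by rewrite /T big_nat_recr.
have DV0 n : 0 <= (boundary n)^-1 by rewrite invr_ge0 ltW.
have ndT : {homo T : n k / (n <= k)%N >-> n <= k}.
  by apply/nondecreasing_seqP => n; rewrite TS lerDl.
(* For [k >= n], [vol n <= vol k], so [vol n] times a tail of the series of [1 / D_k] is at most the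
   tail of that of [V_k / D_k]. *)
have tail n k : vol n * (T (n + k)%N - T n) <= vol_ratio (n + k) - vol_ratio n.
  elim: k => [|k IH]; first by rewrite addn0 !subrr mulr0.
  rewrite addnS TS vol_ratioS.
  have : vol n * (boundary (n + k))^-1 <= vol (n + k) / boundary (n + k).
    by rewrite ler_wpM2r // le_vol ?leq_addr.
  by move: IH; lra.
have T_le n k : T k <= T n + M / vol n.
  apply: (@le_trans _ _ (T (n + k)%N)); first by rewrite ndT ?leq_addl.
  rewrite -lerBlDl ler_pdivlMr ?vol_gt0 // mulrC; apply: (le_trans (tail n k)).
  by rewrite lerBlDr (le_trans (hM _)) // lerDl vol_ratio_ge0.
have cT : cvgn T.
  by apply: nondecreasing_is_cvgn => //; exists (T 0%N + M / vol 0) => _ [k _ <-].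
(* The Green function with pole [x0], as a function of the distance to [x0]. *)
pose w r := limn T - T r.
have w0 r : 0 <= w r by rewrite subr_ge0; exact: nondecreasing_cvgn_le.
have wS r : w r - w r.+1 = (boundary r)^-1 by rewrite /w TS; ring.
have volw n : vol n * w n <= M.
  rewrite mulrC -ler_pdivlMr ?vol_gt0 // lerBlDl; apply: limr_le => //.
  by near=> k; exact: T_le.
(* Summation by parts: [vol n * w n] is the end term, bounded by [volw], and [vol_ratio n] collects
   [vol k * (w k - w k.+1)]. *)
have sumw n : \sum_(y <- gball n) w (dist y) * m y = vol n * w n + vol_ratio n.
  have sphw r : \sum_(y <- sph r) w (dist y) * m y = w r * sphere_meas r.
    rewrite mulr_sumr; apply: eq_big_seq => y; rewrite mem_sph => /eqP -> //.
  elim: n => [|n IH].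
    by rewrite sum_gball0 sphw vol0 /vol_ratio big_nil addr0 mulrC.
  rewrite sum_gballS IH sphw volS vol_ratioS.
  by rewrite -wS; ring.
(* Unit flux through every boundary: [w] is harmonic off [x0], with a positive source there. *)
have flux r : (w r - w r.+1) * boundary r = 1.
  by rewrite wS mulVf ?gt_eqF.
have wL1 : L1 G (fun y => w (dist y)).
  apply: (@le_lt_trans _ _ (M + M)%:E); last exact: ltry.
  apply: esum_le_sum => s us.
  have [n _ /(_ n (leqnn _)) sn] : \forall n \near \oo, {subset s <= gball n}.
    exact: near_gballs.
  apply: (@le_trans _ _ (\sum_(y <- gball n) w (dist y) * m y)).
    apply: (@le_trans _ _ (\sum_(y <- s) w (dist y) * m y)).
      by apply: ler_sum => y _; rewrite ger0_norm.
    apply: le_sum_uniq => //; first exact: gball_uniq.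
      by move=> y /sn ->.
    by move=> y _ _; rewrite mulr_ge0 // ltW ?vmeas_gt0.
  by rewrite sumw lerD.
have lw y : 0 <= laplacian G (fun y => w (dist y)) y.
  case E : (dist y) => [|r]; have := sphere_meas_gt0 y; rewrite E => s0.
    by rewrite -(pmulr_rge0 _ s0) (laplacian_flux0 flux E) ler01.
  by rewrite -(pmulr_rge0 _ s0) (laplacian_fluxS flux E) subrr.
have [c hc] := liou _ (fun y => w0 (dist y)) wL1 lw.
(* [boundary 0 > 0] forces a vertex at distance [1], where [w] differs from its value at [x0]. *)
have [y y1] : exists y, dist y = 1%N.
  apply: contrapT => /forallNP no1; have := D0 0%N.
  rewrite /boundary big1 ?ltxx // => x _; rewrite big_seq big1 // => y.
  by rewrite mem_sph => /eqP /no1.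
have h0 := hc x0; rewrite gdistxx in h0.
have h1 := hc y; rewrite y1 in h1.
have := wS 0%N; rewrite h0 h1 subrr => /esym/eqP.
by rewrite invr_eq0 gt_eqF.
Unshelve. all: by end_near. Qed.

Lemma L1_Liouville_stochastically_complete :
  L1_Liouville G -> stochastically_complete G.
Proof.
move=> liou.
(* A vanishing boundary means a finite graph; otherwise all quotients in [vol_ratio] have positive
   denominators, and boundedness would contradict [liou]. *)
have [[r /eqP r0]|/forallNP D0] := pselect (exists r, boundary r == 0).
  exact: finite_stochastically_complete r0.
have {}D0 r : 0 < boundary r by rewrite lt_neqAle boundary_ge0 andbT eq_sym; apply/negP.
apply: unbounded_stochastically_complete => // M; apply: contrapT => /forallNP hM.
apply: (@bounded_not_L1_Liouville M) => // n.
by rewrite leNgt; apply/negP/hM.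
Qed.

End ModelGraph.

Theorem theorem3p5 (R : realType) (V : countType) (G : graph R V) (x0 : V)
  (hG : model_graph G x0) :
  L1_Liouville G <-> stochastically_complete G.
Proof.
split; first exact: L1_Liouville_stochastically_complete hG.
exact: stochastically_complete_L1_Liouville x0.
Qed.
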